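(* Let $m\ge 1$ be an integer, and let $A,B$ be separated $m$-point sets in the plane $\mathbb{R}^2$ whose union is in general position. Then one can delete at most $2t(A,B)$ of the $m^2$ segments joining $A$ to $B$ so that the remaining segments can be partitioned into $2m-1$ possibly empty crossing families. In particular, one such family has size at least $$\frac{m^2-2t(A,B)}{2m-1}.$$ If $t(A,B)\le m^2/4$, there is a crossing family of size at least $m/4$.
   Context: A planar point set is in general position if no three of its points are collinear. Two planar sets $A,B$ are separated if their convex hulls $\operatorname{conv}(A)$ and $\operatorname{conv}(B)$ are disjoint. A segment joining $A$ to $B$ has one endpoint in $A$ and the other in $B$. A crossing family is a set of segments joining points of $A\cup B$, with all endpoints distinct (no two segments share an endpoint), any two of which intersect in their relative interiors; its size is the number of segments. For distinct points $p,q$, $\ell(p,q)$ denotes the line through $p$ and $q$, and $\binom{X}{2}$ denotes the set of unordered two-element subsets of $X$. The avoidance defect of $A,B$ is $$t(A,B)=\bigl|\{\{a,a'\}\in\tbinom{A}{2}:\ell(a,a')\cap\operatorname{conv}(B)\ne\varnothing\}\bigr|+\bigl|\{\{b,b'\}\in\tbinom{B}{2}:\ell(b,b')\cap\operatorname{conv}(A)\ne\varnothing\}\bigr|.$$ *)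

(* Defs.v *)
From mathcomp Require Import all_boot all_order all_algebra finmap.
From mathcomp Require Import boolp classical_sets reals convex.

Set Implicit Arguments.
Unset Strict Implicit.
Unset Printing Implicit Defensive.

Import Order.TTheory GRing.Theory Num.Theory.

Local Open Scope classical_set_scope.
Local Open Scope ring_scope.

Section PlaneGeometry.
Variable R : realType.

Local Notation plane := 'rV[R]_2.

Implicit Types (p q r x : plane) (X A B s : {fset plane}).
Implicit Types (S F : {fset {fset plane}}).

Definition conv_hull X : set plane := smallest (@convex_set R 'rV[R]_2) [set` X].

Definition line p q : set plane :=
  [set x | exists l : R, x = (1 - l) *: p + l *: q].

Definition open_segment p q : set plane :=
  [set x | exists l : R, 0 < l < 1 /\ x = (1 - l) *: p + l *: q].

Definition general_position X : Prop :=
  forall p q r, p \in X -> q \in X -> r \in X ->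
    p != q -> p != r -> q != r -> ~ line p q r.

Definition separated A B : Prop := conv_hull A `&` conv_hull B = set0.

(* A segment is represented by the unordered pair of its endpoints, that is,
   by a two-element finite set. *)
Definition pairs X : {fset {fset plane}} :=
  [fset s in fpowerset X | #|` s| == 2]%fset.

Definition pair_line s : set plane :=
  [set x | exists p q, [/\ p != q, s = [fset p; q]%fset & line p q x]].

Definition segment_relint s : set plane :=
  [set x | exists p q, [/\ p != q, s = [fset p; q]%fset & open_segment p q x]].

Definition joining_segments A B : {fset {fset plane}} :=
  [fset [fset a; b] | a in A, b in B]%fset.

Definition crossing_family X F : Prop :=
  (F `<=` pairs X)%fset /\
  forall s s', s \in F -> s' \in F -> s != s' ->
    [disjoint s & s']%fset /\ segment_relint s `&` segment_relint s' !=set0.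

Definition avoidance_defect A B : nat :=
  (#|` [fset s in pairs A | `[< pair_line s `&` conv_hull B !=set0 >]]%fset| +
   #|` [fset s in pairs B | `[< pair_line s `&` conv_hull A !=set0 >]]%fset|)%N.

(* The parts are allowed to be empty. *)
Definition partitioned_into (n : nat) (F : 'I_n -> {fset {fset plane}}) S
    : Prop :=
  (\bigcup_(i <- enum 'I_n) F i)%fset = S /\
  forall i j, i != j -> [disjoint F i & F j]%fset.

End PlaneGeometry.

(* Main.v *)
Require Import Defs.
From mathcomp Require Import all_boot all_order all_algebra finmap.
From mathcomp Require Import boolp classical_sets reals.
From mathcomp Require Import interval_inference convex lra zify.

(** A linear functional [X] separates [A] from [B]; let [Y] be the coordinate
    orthogonal to it, and send a point [p] to its dual line of equation
    [y = X p * x - Y p]. The lines of [A] are then less steep than those of [B].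
    A segment [ab] becomes the crossing of the lines of [a] and [b], and two
    segments cross when each of the two dual crossings lies strictly between the
    two lines of the other, below one and above the other ([segments_meet]).

    The level of a segment is the number of dual lines strictly below its
    crossing, that is, the number of points on one side of the line [ab]. It
    takes at most [2 * m - 1] values, and the families are made of the remaining
    segments of each level.

    What spoils a level is a segment [ab] for which another segment of the same
    level lies on the wrong side of the line of [a] or of [b]. Follow the line
    of [a] from left to right and count the lines below it. The count drops at
    the lines of [B] and at the steeper lines of [A], and rises only at the
    crossing with the line of some [a'] in [A] that is less steep. If a segment
    of level [k] is in the wrong position with respect to [a], a discrete
    intermediate value argument ([level_step_up]) gives such a rise from [k] to
    [k + 1] or from [k - 1] to [k], located between two segments of level [k];
    there some line of [B] passes above and another one below, so the line
    through [a] and [a'] meets [conv B] ([line_meets_hull]). Each spoiling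
    segment is charged to one of these rises, injectively within a level, the
    last segment of the level at [a] being charged only when it is itself badly
    placed ([bad_charge]). A pair [{a, a'}] produces a single rise, which
    matters for two levels only, hence at most twice as many deletions as pairs
    of points of [A] counted in the avoidance defect ([card_bad]). The
    reflection [X |-> - X] exchanges [A] and [B] and gives the other half. *)

Set Implicit Arguments.
Unset Strict Implicit.
Unset Printing Implicit Defensive.

Import Order.TTheory GRing.Theory Num.Theory.
Local Open Scope ring_scope.

(** * Levels in the dual line arrangement *)

Section Duality.
Variables (R : realFieldType) (T : Type) (X Y : T -> R).
Implicit Types (p q : T) (x : R).

(** Height at abscissa [x] of the line dual to the point with coordinates
    [(X p, Y p)]. *)
Definition dual p x := X p * x - Y p.

(** Abscissa of the crossing of two dual lines, that is, the slope of the line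
    through the two points. It is meaningful only when [X p] and [X q] differ. *)
Definition cross_at p q := (Y p - Y q) / (X p - X q).

Lemma cross_atC p q : cross_at p q = cross_at q p.
Proof. by rewrite /cross_at -(opprB (Y q)) -(opprB (X q)) invrN mulrNN. Qed.

Lemma dual_subE p q x : X q < X p ->
  dual p x - dual q x = (X p - X q) * (x - cross_at p q).
Proof.
move=> lt_qp; rewrite /dual /cross_at mulrBr mulrCA divff; last first.
  by rewrite subr_eq0 gt_eqF.
by rewrite mulr1 mulrBl; lra.
Qed.

Lemma lt_dual p q x : X q < X p -> (dual q x < dual p x) = (cross_at p q < x).
Proof.
move=> lt_qp; rewrite -subr_gt0 dual_subE// pmulr_rgt0 ?subr_gt0//.
Qed.

Lemma gt_dual p q x : X q < X p -> (dual p x < dual q x) = (x < cross_at p q).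
Proof.
move=> lt_qp; rewrite -subr_lt0 dual_subE// pmulr_rlt0 ?subr_gt0// subr_lt0//.
Qed.

Lemma eq_dual p q x : X q < X p -> (dual p x == dual q x) = (x == cross_at p q).
Proof.
move=> lt_qp; rewrite -subr_eq0 dual_subE// mulf_eq0 !subr_eq0.
by rewrite (gt_eqF lt_qp).
Qed.

Lemma dual_cross p q : X q < X p ->
  dual p (cross_at p q) = dual q (cross_at p q).
Proof. by move=> lt_qp; apply/eqP; rewrite eq_dual. Qed.

End Duality.

Section Levels.
Variables (R : realFieldType) (T : finType) (X Y : T -> R).
Implicit Types (c p q : T) (x s : R).

Local Notation dual := (dual X Y).
Local Notation cross_at := (cross_at X Y).

(** Number of dual lines strictly below the line of [p] at abscissa [x]. *)
Definition level p x : nat := #|[set q | dual q x < dual p x]|.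

(** Number of dual lines below the line of [p] just before abscissa [x]. *)
Definition level_before p x : nat :=
  #|[set q | (dual q x < dual p x) ||
             ((dual q x == dual p x) && (X p < X q))]|.

(** Number of dual lines below the line of [p] just after abscissa [x]. *)
Definition level_after p x : nat :=
  #|[set q | (dual q x < dual p x) ||
             ((dual q x == dual p x) && (X q < X p))]|.

Lemma level_le_before p x : (level p x <= level_before p x)%N.
Proof. by apply/subset_leq_card/fintype.subsetP => q; rewrite !inE => ->. Qed.

Lemma level_lt p q x : dual p x < dual q x -> (level p x < level q x)%N.
Proof.
move=> lt_pq; apply/proper_card/properP; split.
  by apply/fintype.subsetP => r; rewrite !inE => /lt_trans; apply.
by exists p; rewrite !inE ?ltxx.
Qed.

Lemma level_before_gt p q x : dual q x = dual p x -> X p < X q ->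
  (level p x < level_before p x)%N.
Proof.
move=> eq_qp lt_pq; apply/proper_card/properP; split.
  by apply/fintype.subsetP => r; rewrite !inE => ->.
by exists q; rewrite !inE ?eq_qp ?eqxx ?lt_pq ?orbT ?ltxx.
Qed.

(** Without a crossing with a less steep line in between, the level of a dual
    line does not increase. *)
Lemma level_before_le_after p s x : s < x ->
    (forall c, X c < X p -> s < cross_at p c -> x <= cross_at p c) ->
  (level_before p x <= level_after p s)%N.
Proof.
move=> lt_sx no_up; apply/subset_leq_card/fintype.subsetP => q; rewrite !inE.
case: (ltgtP (X q) (X p)) => [lt_qp|lt_pq|eqX].
- rewrite andbF orbF andbT lt_dual// => lt_x.
  rewrite lt_dual// (eq_sym (dual q s)) eq_dual//.
  have := no_up q lt_qp; rewrite leNgt lt_x /=.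
  by case: (ltgtP (cross_at p q) s) => // lt_s /(_ isT).
- rewrite andbT andbF orbF gt_dual// eq_dual// => le_x.
  rewrite gt_dual// (lt_le_trans lt_sx)//.
  by case/orP: le_x => [/ltW//|/eqP ->].
- by rewrite !andbF !orbF /dual eqX; lra.
Qed.

Lemma level_before_le p s x : s < x ->
    (forall c, X c < X p -> s <= cross_at p c -> x <= cross_at p c) ->
  (level_before p x <= level p s)%N.
Proof.
move=> lt_sx no_up; apply/subset_leq_card/fintype.subsetP => q; rewrite !inE.
case: (ltgtP (X q) (X p)) => [lt_qp|lt_pq|eqX].
- rewrite andbF orbF !lt_dual// => lt_x.
  rewrite ltNge; apply/negP => /(no_up q lt_qp).
  by rewrite leNgt lt_x.
- rewrite andbT gt_dual// eq_dual// => le_x.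
  rewrite gt_dual// (lt_le_trans lt_sx)//.
  by case/orP: le_x => [/ltW//|/eqP ->].
- by rewrite !andbF !orbF /dual eqX; lra.
Qed.

Hypothesis no_concurrent : forall p q r x, p != q -> p != r -> q != r ->
  dual p x = dual q x -> dual p x <> dual r x.

Lemma level_after_le p x : (level_after p x <= (level p x).+1)%N.
Proof.
pose E := [set q | (dual q x == dual p x) && (X q < X p)].
have E_le1 : (#|E| <= 1)%N.
  apply/card_le1P => q; rewrite inE => /andP[/eqP eqq ltq] r; rewrite !inE.
  apply/idP/eqP => [/andP[/eqP eqr ltr]|->]; last by rewrite eqq eqxx ltq.
  apply/eqP/negPn/negP => neq.
  have [nq nr] : p != q /\ p != r.
    by split; apply/eqP => e; [move: ltq | move: ltr]; rewrite e ltxx.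
  by apply: (no_concurrent nq nr _ (esym eqq) (esym eqr)); rewrite eq_sym.
rewrite -addn1; apply: leq_trans (leq_add (leqnn _) E_le1).
apply: leq_trans (leq_card_setU _ _).
by apply/subset_leq_card/fintype.subsetP => q; rewrite !inE.
Qed.

(** Discrete intermediate value theorem: if the level of the dual line of [p]
    rises from at most [k] to above [k] between [s] and [x], it steps up from
    [k] to [k.+1] at a crossing with a less steep line. *)
Lemma level_step_up p k s x : s < x ->
    (level p s <= k)%N -> (k < level_before p x)%N ->
  exists c, [/\ X c < X p, s <= cross_at p c, cross_at p c < x
              & level p (cross_at p c) = k].
Proof.
pose E y := [set c | [&& X c < X p, s <= cross_at p c & cross_at p c < y]].
move=> + le_k; have [n] := ubnP #|E x|.
elim: n x => // n IHn x ltEn lt_sx gt_k.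
have [E0|[c0 c0E]] := set_0Vmem (E x).
  have : (level_before p x <= level p s)%N.
    apply: level_before_le => // c ltc lec; rewrite leNgt; apply/negP => ltx.
    by have := finset.in_set0 c; rewrite -E0 inE ltc lec ltx.
  by move=> /(leq_trans gt_k); rewrite ltnNge le_k.
(* the last rise before x *)
case: (@arg_maxP _ _ _ c0 (fun c => c \in E x) (cross_at p) c0E) => c;
  rewrite inE => /and3P[ltc les ltx] cmax.
set t := cross_at p c in les ltx cmax *.
have gt_kt : (k <= level p t)%N.
  rewrite -ltnS; apply: leq_trans (level_after_le p t).
  apply: leq_trans gt_k (level_before_le_after ltx _) => d ltd lt_td.
  rewrite leNgt; apply/negP => lt_dx.
  have : d \in E x by rewrite inE ltd lt_dx (ltW (le_lt_trans les lt_td)).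
  by move=> /cmax /=; rewrite leNgt lt_td.
have [ekt|nkt] := eqVneq (level p t) k; first by exists c; split.
have {nkt}gt_kt : (k < level p t)%N by rewrite ltn_neqAle eq_sym nkt.
have lt_st : s < t.
  rewrite lt_neqAle les andbT; apply/eqP => est.
  by move: gt_kt; rewrite -est ltnNge le_k.
have gt_kt' := leq_trans gt_kt (level_le_before p t).
have [|d [d1 d2 d3 d4]] := IHn t _ lt_st gt_kt'.
  rewrite -ltnS; apply: leq_trans ltEn; rewrite ltnS.
  apply/proper_card/properP; split.
    apply/fintype.subsetP => d; rewrite !inE => /and3P[-> -> /lt_trans-> //].
  by exists c; rewrite !inE ?ltc ?les ?ltx // ltxx.
by exists d; split => //; apply: lt_trans ltx.
Qed.

End Levels.

(** * Charging bad segments to defective pairs *)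

Section Charging.
Variables (R : realFieldType) (T : finType) (X Y : T -> R) (A : {set T}).
Implicit Types (a b c : T) (u v : T * T).

Hypothesis no_concurrent : forall p q r x, p != q -> p != r -> q != r ->
  dual X Y p x = dual X Y q x -> dual X Y p x <> dual X Y r x.
Hypothesis X_lt : forall a b, a \in A -> b \notin A -> X a < X b.

Let h := dual X Y.
Let cr := cross_at X Y.

(** Number of points on one fixed side of the line through [a] and [b]. *)
Definition segment_level a b := level X Y a (cross_at X Y a b).

(** The pairs consisting of a point of [A] and a point outside [A]. *)
Definition bichromatic := [set v : T * T | (v.1 \in A) && (v.2 \notin A)].

(** A pair [v = (a, b)] is bad when some pair [u] of the same level lies, in the
    dual, on the wrong side of the line of [a]: to the right of [v] but not
    above this line, or to the left of [v] but not below it. Pairs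
    sharing [a] are compared to the right only: when several pairs of a level
    share [a], all of them but the rightmost one are bad. *)
Definition bad v := (v \in bichromatic) &&
  [exists u, [&& u \in bichromatic,
    segment_level u.1 u.2 == segment_level v.1 v.2 &
    ((cr v.1 v.2 < cr u.1 u.2) &&
       (h u.1 (cr u.1 u.2) <= h v.1 (cr u.1 u.2))) ||
    [&& u.1 != v.1, cr u.1 u.2 < cr v.1 v.2 &
       h v.1 (cr u.1 u.2) <= h u.1 (cr u.1 u.2)]]].

(** [(a, c)] is an ordered pair of points of [A] whose line has points outside
    [A] on both sides. *)
Definition defective w :=
  [&& w.1 \in A, w.2 \in A, X w.2 < X w.1,
    [exists b, (b \notin A) && (h w.1 (cr w.1 w.2) < h b (cr w.1 w.2))] &
    [exists b, (b \notin A) && (h b (cr w.1 w.2) < h w.1 (cr w.1 w.2))]].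

(** How a bad pair [(a, b)] may be charged to the pair [(a, c)] with tag [e]. At
    the crossing of [a] and [c] the level of [a] steps up, from [k] to [k.+1]
    if [e = false] and from [k.-1] to [k] if [e = true], where [k] is the level
    of [(a, b)]. The last clause makes [b] unique. *)
Let charge v c (e : bool) :=
  [/\ defective (v.1, c),
      (level X Y v.1 (cr v.1 c) + e)%N = segment_level v.1 v.2
    & if e then
        forall b, b \notin A ->
          segment_level v.1 b = segment_level v.1 v.2 ->
          cr v.1 b <= cr v.1 v.2
      else cr v.1 v.2 < cr v.1 c /\
        forall b, b \notin A ->
          segment_level v.1 b = segment_level v.1 v.2 ->
          cr v.1 v.2 < cr v.1 b -> cr v.1 c < cr v.1 b].

Lemma not_bad_right u v : u \in bichromatic -> v \in bichromatic ->
    segment_level u.1 u.2 = segment_level v.1 v.2 -> ~~ bad v ->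
  cr v.1 v.2 < cr u.1 u.2 -> h v.1 (cr u.1 u.2) < h u.1 (cr u.1 u.2).
Proof.
move=> uS vS eqK + lt; rewrite /bad vS ltNge; apply: contraNN => le.
by apply/existsP; exists u; rewrite uS eqK eqxx lt le.
Qed.

Lemma not_bad_left u v : u \in bichromatic -> v \in bichromatic ->
    segment_level u.1 u.2 = segment_level v.1 v.2 -> ~~ bad v -> u.1 != v.1 ->
  cr u.1 u.2 < cr v.1 v.2 -> h u.1 (cr u.1 u.2) < h v.1 (cr u.1 u.2).
Proof.
move=> uS vS eqK + na lt; rewrite /bad vS ltNge; apply: contraNN => le.
by apply/existsP; exists u; rewrite uS eqK eqxx na lt le orbT.
Qed.

Let neqA a b : a \in A -> b \notin A -> a != b.
Proof. by move=> aA; apply: contraNneq => <-. Qed.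

Let h_cr a b : a \in A -> b \notin A -> h a (cr a b) = h b (cr a b).
Proof.
move=> aA bA; rewrite /cr cross_atC; apply/esym.
by apply: dual_cross; apply: X_lt.
Qed.

Let h_ltl a b x : a \in A -> b \notin A -> (h a x < h b x) = (cr a b < x).
Proof. by move=> aA bA; rewrite /cr cross_atC lt_dual// X_lt. Qed.

Let h_gtl a b x : a \in A -> b \notin A -> (h b x < h a x) = (x < cr a b).
Proof. by move=> aA bA; rewrite /cr cross_atC gt_dual// X_lt. Qed.

Let lt_memA a c : a \in A -> X c < X a -> c \in A.
Proof. by move=> aA; apply: contraTT => /(X_lt aA); rewrite -leNgt => /ltW. Qed.

Let no_third a c b : a \in A -> X c < X a -> b \notin A -> cr a c != cr a b.
Proof.
move=> aA lt_ca bA; have cA := lt_memA aA lt_ca.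
have nac : a != c by apply: contraTneq lt_ca => ->; rewrite ltxx.
apply/eqP => e; apply: (no_concurrent (x := cr a b) nac (neqA aA bA)).
- exact: neqA.
- by rewrite -e; apply: dual_cross.
- exact: h_cr.
Qed.

Let level_gt_segment a b :
  a \in A -> b \notin A -> (segment_level a b < level_before X Y a (cr a b))%N.
Proof.
move=> aA bA; apply: (level_before_gt (q := b)); last exact: X_lt.
by rewrite -/h -h_cr.
Qed.

Let above_neq a a' b' : a \in A -> a' \in A -> b' \notin A -> a' != a ->
  h a (cr a' b') != h a' (cr a' b').
Proof.
move=> aA a'A b'A na; apply/eqP => e.
apply: (no_concurrent (x := cr a' b') na (neqA a'A b'A)); last exact: h_cr.
  exact: neqA.
by rewrite -/h e.
Qed.

Let defectiveI a c b b' : a \in A -> X c < X a -> b \notin A -> b' \notin A ->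
  cr a b < cr a c -> h b' (cr a c) < h a (cr a c) -> defective (a, c).
Proof.
move=> aA ltc bA b'A lt1 lt2; rewrite /defective /= aA (lt_memA aA ltc) ltc /=.
apply/andP; split; apply/existsP; first by exists b; rewrite bA h_ltl.
by exists b'; rewrite b'A.
Qed.

Lemma bad_charge v : bad v -> exists c e, charge v c e.
Proof.
case: v => a b; rewrite /bad inE /= => /andP[/andP[aA bA] /existsP[[a' b']]].
rewrite inE /= => /andP[/andP[a'A b'A] /andP[/eqP eqK side]].
have step_after s' : cr a b < s' ->
    (segment_level a b < level_before X Y a s')%N ->
  exists c, [/\ X c < X a, cr a b < cr a c, cr a c < s'
              & level X Y a (cr a c) = segment_level a b].
  move=> lts gtK.
  have [c [c1 c2 c3 c4]] := level_step_up no_concurrent lts (leqnn _) gtK.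
  by exists c; split => //; rewrite lt_neqAle c2 eq_sym no_third.
pose later := [set b1 | [&& b1 \notin A,
  segment_level a b1 == segment_level a b & cr a b < cr a b1]].
have [later0|[b0 b0later]] := set_0Vmem later; last first.
  (* the next pair of this level on the line of a *)
  case: (@arg_minP _ _ _ b0 (fun b1 => b1 \in later) (cr a) b0later) => b1.
  rewrite inE => /and3P[b1A /eqP eqK1 lt1] b1min.
  have [|c [c1 c2 c3 c4]] := step_after _ lt1.
    by rewrite -eqK1 level_gt_segment.
  exists c, false; split => /=; last 1 first.
  - split=> // b2 b2A eqK2 lt2; apply: lt_le_trans c3 _.
    by have := b1min b2; rewrite inE b2A eqK2 eqxx lt2; apply.
  - by apply: (defectiveI aA c1 bA b1A) => //; rewrite h_gtl.
  - by rewrite addn0.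
have last b1 : b1 \notin A -> segment_level a b1 = segment_level a b ->
    cr a b1 <= cr a b.
  move=> b1A eqK1; rewrite leNgt; apply/negP => lt1.
  by have := finset.in_set0 b1; rewrite -later0 inE b1A eqK1 eqxx lt1.
case/orP: side => [/andP[lts le_h]|/and3P[na lts le_h]].
- have na : a' != a.
    apply: contraTneq lts => ea; rewrite -leNgt ea.
    by apply: last; rewrite // -eqK ea.
  have {le_h}lt_h : h a' (cr a' b') < h a (cr a' b').
    by rewrite lt_neqAle le_h eq_sym above_neq.
  have [|c [c1 c2 c3 c4]] := step_after _ lts.
    rewrite -eqK; apply: leq_trans (level_le_before _ _ _ _).
    exact: level_lt.
  exists c, false; split => /=; last 1 first.
  - by split=> // b2 b2A eqK2; rewrite ltNge last.
  - apply: (defectiveI aA c1 bA b'A) => //.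
    rewrite h_gtl //; apply: lt_trans c3 _.
    by rewrite -h_gtl // -(h_cr a'A b'A).
  - by rewrite addn0.
- have {le_h}lt_h : h a (cr a' b') < h a' (cr a' b').
    by rewrite lt_neqAle le_h above_neq.
  have ltK : (level X Y a (cr a' b') < segment_level a b)%N.
    by rewrite -eqK; apply: level_lt.
  have leK : (level X Y a (cr a' b') <= (segment_level a b).-1)%N.
    by rewrite -ltnS (ltn_predK ltK).
  have [|c [c1 c2 c3 c4]] := level_step_up no_concurrent lts leK.
    rewrite (ltn_predK ltK); apply/ltnW; exact: level_gt_segment.
  exists c, true; split => /=; last 1 first.
  - by move=> b1; apply: last.
  - apply: (@defectiveI a c b' b) => //; last by rewrite h_gtl.
    apply: lt_le_trans c2.
    by rewrite -h_ltl // -(h_cr a'A b'A).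
  - by rewrite c4 addn1 (ltn_predK ltK).
Qed.

Let cr_inj a b b' : a \in A -> b \notin A -> b' \notin A ->
  cr a b = cr a b' -> b = b'.
Proof.
move=> aA bA b'A e; apply/eqP/negPn/negP => nb.
apply: (no_concurrent (x := cr a b) (neqA aA bA) (neqA aA b'A) nb).
  exact: h_cr.
by rewrite e; apply: h_cr.
Qed.

(** Each defective pair is charged at most twice. *)
Lemma card_bad :
  (#|[set v | bad v]| <= 2 * #|[set w | defective w]|)%N.
Proof.
have [f fP] : exists f : T * T -> T * bool,
    forall v, bad v -> charge v (f v).1 (f v).2.
  have /choice[f fP] v : exists ce : T * bool, bad v -> charge v ce.1 ce.2.
    case: (boolP (bad v)) => [/bad_charge[c [e ?]]|_]; first by exists (c, e).
    by exists (v.1, true).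
  by exists f.
pose g v := ((v.1, (f v).1), (f v).2).
have g_inj : {in [set v | bad v] &, injective g}.
  move=> [a b] [a' b']; rewrite !inE /g /= => bad_v bad_u [ea ec ee].
  have := fP _ bad_v; have := fP _ bad_u; rewrite -ee -ec -ea.
  move: bad_v bad_u; rewrite /bad !inE /= -ea.
  move=> /andP[/andP[aA bA] _] /andP[/andP[_ b'A] _].
  case: (f (a, b)) => c e [/= _ e1 H1] [/= _ e2 H2].
  congr (_, _); apply: (cr_inj aA bA b'A).
  have eqK : segment_level a b = segment_level a b' by rewrite -e2 -e1.
  case: e H1 H2 {e1 e2 ee} => [H1 H2|[H1 H1'] [H2 H2']].
    by apply/eqP; rewrite eq_le H1 ?H2.
  apply/eqP; rewrite eq_le !leNgt; apply/andP; split; apply/negP => lt.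
    by have := lt_trans (H1' b bA eqK lt) H2; rewrite ltxx.
  by have := lt_trans (H2' b' b'A (esym eqK) lt) H1; rewrite ltxx.
rewrite -(card_in_imset g_inj) mulnC -card_bool -cardsT -cardsX.
apply/subset_leq_card/fintype.subsetP => _ /imsetP[v + ->].
by rewrite !inE /= andbT => /fP[].
Qed.

End Charging.

(** * Both sides together *)

Section Mirror.
Variables (R : realFieldType) (T : finType) (X Y : T -> R).
Implicit Types (p q : T) (x : R).

Let NX p := - X p.

Lemma dual_mirror p x : dual NX Y p x = dual X Y p (- x).
Proof. by rewrite /dual /NX mulrN mulNr. Qed.

Lemma cross_at_mirror p q : cross_at NX Y p q = - cross_at X Y p q.
Proof. by rewrite /cross_at /NX -opprD invrN mulrN. Qed.

Lemma level_mirror p x : level NX Y p x = level X Y p (- x).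
Proof.
by rewrite /level; apply: eq_card => q; rewrite !inE !dual_mirror.
Qed.

Lemma segment_level_mirror p q : X q < X p ->
  segment_level NX Y p q = segment_level X Y q p.
Proof.
move=> lt_qp; rewrite /segment_level level_mirror cross_at_mirror opprK.
rewrite (cross_atC X Y q); apply: eq_card => r; rewrite !inE.
by rewrite (dual_cross Y lt_qp).
Qed.

End Mirror.

Section Crossing.
Variables (R : realFieldType) (T : finType) (X Y : T -> R) (A : {set T}).
Implicit Types (u v : T * T).

Hypothesis no_concurrent : forall p q r x, p != q -> p != r -> q != r ->
  dual X Y p x = dual X Y q x -> dual X Y p x <> dual X Y r x.
Hypothesis X_lt : forall a b, a \in A -> b \notin A -> X a < X b.

Let h := dual X Y.
Let cr v := cross_at X Y v.1 v.2.
Let K v := segment_level X Y v.1 v.2.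
Let NX p := - X p.
Let swap v := (v.2, v.1).

(** A pair is good when it is not bad, neither with respect to its endpoint in
    [A] nor, after the reflection [X |-> - X], to its other endpoint. *)
Definition good v := ~~ bad X Y A v && ~~ bad NX Y (~: A) (swap v).

Let no_concurrentN p q r x : p != q -> p != r -> q != r ->
  dual NX Y p x = dual NX Y q x -> dual NX Y p x <> dual NX Y r x.
Proof. by rewrite !dual_mirror; apply: no_concurrent. Qed.

Let X_ltN a b : a \in ~: A -> b \notin ~: A -> NX a < NX b.
Proof. by rewrite !inE negbK ltrN2 => aA bA; apply: X_lt. Qed.

Let h_cr v : v \in bichromatic A -> h v.1 (cr v) = h v.2 (cr v).
Proof.
rewrite inE => /andP[v1 v2]; rewrite /cr cross_atC; apply/esym.
by apply: dual_cross; apply: X_lt.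
Qed.

Let swap_bichromatic v : v \in bichromatic A -> swap v \in bichromatic (~: A).
Proof. by rewrite !inE negbK andbC. Qed.

Let K_swap v : v \in bichromatic A ->
  segment_level NX Y (swap v).1 (swap v).2 = K v.
Proof.
by rewrite inE => /andP[v1 v2]; apply: segment_level_mirror; apply: X_lt.
Qed.

Let cr_swap v : cross_at NX Y (swap v).1 (swap v).2 = - cr v.
Proof. by rewrite cross_at_mirror cross_atC. Qed.

Lemma same_level_cross_neq u v : u \in bichromatic A -> v \in bichromatic A ->
  u != v -> K u = K v -> cr u != cr v.
Proof.
move=> uS vS nuv eqK; apply/eqP => e.
have := h_cr uS; have := h_cr vS; rewrite -e.
move: eqK uS vS; rewrite /K /segment_level -/(cr u) -/(cr v) -e !inE.
move: nuv; rewrite -pair_eqE /pair_eq /=.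
have [ea|na] := eqVneq u.1 v.1 => /= nb eqK /andP[uA uB] /andP[vA vB] e1 e2.
  apply: (no_concurrent _ _ nb e2); rewrite -/h.
  - by apply: contraNneq uB => <-.
  - by apply: contraNneq vB => <-; rewrite ea.
  - by rewrite -e1 ea.
have nu : u.1 != u.2 by apply: contraNneq uB => <-.
have nv : v.1 != u.2 by apply: contraNneq uB => <-.
have [lt|lt|e3] := ltgtP (h u.1 (cr u)) (h v.1 (cr u)).
- by have := level_lt lt; rewrite eqK ltnn.
- by have := level_lt lt; rewrite eqK ltnn.
- exact: (no_concurrent na nu nv e3).
Qed.

(** In the dual, two good pairs of one level each lie between the two lines of
    the other. *)
Lemma good_cross u v : u \in bichromatic A -> v \in bichromatic A ->
    good u -> good v -> K u = K v -> cr u < cr v ->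
  [/\ h v.2 (cr u) < h u.1 (cr u), h u.1 (cr u) < h v.1 (cr u),
      h u.1 (cr v) < h v.1 (cr v) & h v.1 (cr v) < h u.2 (cr v)].
Proof.
move=> uS vS /andP[ua ub] /andP[va vb] eqK lt.
have lt1 : h u.1 (cr v) < h v.1 (cr v) by apply: not_bad_right ua _.
have lt2 : h u.1 (cr u) < h v.1 (cr u).
  apply: not_bad_left va _ _ => //.
  by apply: contraTneq lt1 => ->; rewrite ltxx.
have [uS' vS'] := (swap_bichromatic uS, swap_bichromatic vS).
have eqK' : segment_level NX Y (swap u).1 (swap u).2 =
            segment_level NX Y (swap v).1 (swap v).2 by rewrite !K_swap.
have lt' : cross_at NX Y (swap v).1 (swap v).2 <
           cross_at NX Y (swap u).1 (swap u).2 by rewrite !cr_swap ltrN2.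
have := not_bad_right uS' vS' eqK' vb lt'.
rewrite !cr_swap !dual_mirror !opprK -/h /= -(h_cr uS) => lt3.
have n2 : (swap v).1 != (swap u).1.
  by apply: contraTneq lt3 => /= ->; rewrite (h_cr uS) ltxx.
have := not_bad_left vS' uS' (esym eqK') ub n2 lt'.
rewrite !cr_swap !dual_mirror !opprK -/h /= -(h_cr vS) => lt4.
by split.
Qed.

Lemma card_not_good :
  (#|[set v in bichromatic A | ~~ good v]| <=
     2 * (#|[set w | defective X Y A w]| +
          #|[set w | defective NX Y (~: A) w]|))%N.
Proof.
rewrite mulnDr.
apply: leq_trans (leq_add (card_bad no_concurrent X_lt)
                          (card_bad no_concurrentN X_ltN)).
have swap_inj : injective swap by move=> [? ?] [? ?] [-> ->].
rewrite -(card_preimset [set v | bad NX Y (~: A) v] swap_inj).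
apply: leq_trans (leq_card_setU _ _).
apply/subset_leq_card/fintype.subsetP => v; rewrite !inE negb_and !negbK.
by move=> /andP[_ ->].
Qed.

End Crossing.

(** * Separating two finite sets of the plane *)

Section Separation.
Variable R : realType.
Local Notation plane := 'rV[R]_2.
Implicit Types (p q u v w : plane) (A B X : {fset plane}).

Lemma plane_eq p q : p 0 0 = q 0 0 -> p 0 1 = q 0 1 -> p = q.
Proof.
move=> e0 e1; apply/rowP => i.
have [->|->] : i = 0 \/ i = 1; last by [].
  by case: i => [[|[|//]] ilt]; [left|right]; apply: val_inj.
by [].
Qed.

(** The scalar product. *)
Definition dot u v := u 0 0 * v 0 0 + u 0 1 * v 0 1.

(** The determinant of [u] and [v]; together with [dot u], it gives coordinates
    of [v] in the orthogonal frame of [u] and its rotation by a right angle. *)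
Definition det2 u v := u 0 0 * v 0 1 - u 0 1 * v 0 0.

Lemma dotDl u w v : dot (u + w) v = dot u v + dot w v.
Proof. by rewrite /dot !mxE; lra. Qed.

Lemma dotZl (l : R) u v : dot (l *: u) v = l * dot u v.
Proof. by rewrite /dot !mxE; lra. Qed.

Lemma dotDr u w v : dot u (w + v) = dot u w + dot u v.
Proof. by rewrite /dot !mxE; lra. Qed.

Lemma dotZr (l : R) u v : dot u (l *: v) = l * dot u v.
Proof. by rewrite /dot !mxE; lra. Qed.

Lemma det2Dr u w v : det2 u (w + v) = det2 u w + det2 u v.
Proof. by rewrite /det2 !mxE; lra. Qed.

Lemma det2Zr (l : R) u v : det2 u (l *: v) = l * det2 u v.
Proof. by rewrite /det2 !mxE; lra. Qed.

Lemma dot_gt0 u : u != 0 -> 0 < dot u u.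
Proof.
move=> u0; rewrite lt_neqAle addr_ge0 ?sqr_ge0// andbT eq_sym.
apply: contraNneq u0 => /eqP; rewrite paddr_eq0 ?sqr_ge0// !mulf_eq0 !orbb.
by move=> /andP[/eqP e0 /eqP e1]; apply/eqP/plane_eq; rewrite mxE.
Qed.

(** The vector [u] rotated by a right angle. *)
Definition perp u : plane := \row_i (if i == 0 then - u 0 1 else u 0 0).

Lemma dot_perp u v : dot (perp u) v = det2 u v.
Proof. by rewrite /dot /det2 !mxE /=; lra. Qed.

Lemma dot_det2_inj u p q : u != 0 -> dot u p = dot u q -> det2 u p = det2 u q ->
  p = q.
Proof.
move=> u0 eX eY; have uu0 : dot u u != 0 by rewrite gt_eqF ?dot_gt0.
apply: plane_eq; apply: (mulfI uu0).
  have -> v : dot u u * v 0 0 = u 0 0 * dot u v - u 0 1 * det2 u v.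
    by rewrite /dot /det2; lra.
  by rewrite eX eY; rewrite /dot /det2; lra.
have -> v : dot u u * v 0 1 = u 0 1 * dot u v + u 0 0 * det2 u v.
  by rewrite /dot /det2; lra.
by rewrite eX eY; rewrite /dot /det2; lra.
Qed.

Lemma small_perturbation (T : eqType) (f g : T -> R) (s : seq T) :
  {in s, forall x, 0 < f x} ->
  exists e0, 0 < e0 /\
    forall e, 0 < e -> e <= e0 -> {in s, forall x, 0 < f x + e * g x}.
Proof.
elim: s => [|x s IHs] fs; first by exists 1; split.
have [|e1 [e1_gt0 e1P]] := IHs.
  by move=> y ys; rewrite fs// in_cons ys orbT.
have fx : 0 < f x by rewrite fs ?mem_head.
have gx : 0 < `|g x| + 1 by rewrite ltr_pwDr.
exists (Num.min e1 (f x / (`|g x| + 1))); split.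
  by rewrite lt_min e1_gt0 divr_gt0.
move=> e e_gt0; rewrite le_min ler_pdivlMr// => /andP[le1 le2] y.
rewrite in_cons => /predU1P[->|ys]; last exact: e1P.
have : - `|g x| <= g x by rewrite lerNl -normrN ler_norm.
by nra.
Qed.

(** Gordan's alternative in the plane: finitely many vectors of a convex cone
    that omits the origin lie in an open half-plane. *)
Lemma open_half_plane (C : plane -> Prop) (s : seq plane) :
    (forall v w, C v -> C w -> C (v + w)) ->
    (forall l v, 0 < l -> C v -> C (l *: v)) ->
    ~ C 0 ->
    (forall v, v \in s -> C v) ->
  exists u, forall v, v \in s -> 0 < dot u v.
Proof.
move=> CD CZ C0; elim: s => [|w s IHs] Cs; first by exists 0.
have [|u uP] := IHs; first by move=> v vs; apply: Cs; rewrite in_cons vs orbT.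
have Cw : C w by apply: Cs; rewrite mem_head.
have {}Cs v : v \in s -> C v by move=> vs; apply: Cs; rewrite in_cons vs orbT.
have w0 : w != 0 by apply: contra_notN C0 => /eqP <-.
have [uw|uw] := ltP 0 (dot u w).
  by exists u => v; rewrite in_cons => /predU1P[->//|]; apply: uP.
have half_plane (z : R) : {in s, forall v, 0 < z * det2 w v} ->
    exists u, forall v, v \in w :: s -> 0 < dot u v.
  move=> zP; have [e [e_gt0 eP]] := small_perturbation (dot w) zP.
  exists (z *: perp w + e *: w) => v.
  rewrite dotDl !dotZl dot_perp in_cons => /predU1P[->|vs].
    by rewrite /det2 [w 0 1 * _]mulrC subrr mulr0 add0r mulr_gt0// dot_gt0.
  exact: eP.
have [/allP pos|/allPn[v1 v1s]] := boolP (all (fun v => 0 < det2 w v) s).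
  by apply: (half_plane 1) => v vs; rewrite mul1r pos.
rewrite -leNgt => d1.
have [/allP neg|/allPn[v2 v2s]] := boolP (all (fun v => det2 w v < 0) s).
  by apply: (half_plane (-1)) => v vs; rewrite mulN1r oppr_gt0 neg.
rewrite -leNgt => d2; case: C0.
(* a vector of the cone on the line of w, on the positive side of u *)
have [p [Cp dp up]] : exists p, [/\ C p, det2 w p = 0 & 0 < dot u p].
  have [e1|n1] := eqVneq (det2 w v1) 0; first by exists v1; split; auto.
  have [e2|n2] := eqVneq (det2 w v2) 0; first by exists v2; split; auto.
  have {n1}d1 : 0 < - det2 w v1 by rewrite oppr_gt0 lt_neqAle n1.
  have {n2}d2 : 0 < det2 w v2 by rewrite lt_neqAle eq_sym n2.
  exists (det2 w v2 *: v1 + (- det2 w v1) *: v2); split.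
  - by apply: CD; apply: CZ => //; apply: Cs.
  - by rewrite det2Dr !det2Zr; lra.
  - by rewrite dotDr !dotZr addr_gt0 ?mulr_gt0 ?uP.
have e0 : dot u p *: w - dot u w *: p = 0.
  apply: plane_eq; rewrite !mxE.
    have -> : dot u p * w 0 0 - dot u w * p 0 0 = u 0 1 * det2 w p.
      by rewrite /dot /det2; lra.
    by rewrite dp mulr0.
  have -> : dot u p * w 0 1 - dot u w * p 0 1 = - u 0 0 * det2 w p.
    by rewrite /dot /det2; lra.
  by rewrite dp mulr0.
rewrite -e0; have [->|nuw] := eqVneq (dot u w) 0.
  by rewrite scale0r subr0; apply: CZ.
rewrite -scaleNr; apply: CD; apply: CZ => //.
by rewrite oppr_gt0 lt_neqAle nuw.
Qed.

Lemma sub_conv_hull X p : p \in X -> conv_hull X p.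
Proof. by move=> pX; apply: sub_gen_smallest. Qed.

Lemma conv_hull_conv X p q (l : R) : 0 <= l -> l <= 1 ->
  conv_hull X p -> conv_hull X q -> conv_hull X ((1 - l) *: p + l *: q).
Proof.
move=> l0 l1 Xp Xq M MP; have [convM _] := MP.
have Mp : p \in M by rewrite inE; apply: Xp.
have Mq : q \in M by rewrite inE; apply: Xq.
by have := convM _ _ (Itv01 l0 l1) Mq Mp; rewrite inE addrC.
Qed.

(** The cone generated by the differences [b - a], with [a] and [b] in the two
    hulls, is convex and omits the origin, so its generators lie in an open
    half-plane. *)
Lemma separated_dot A B : separated A B ->
  exists u, forall a b, a \in A -> b \in B -> dot u a < dot u b.
Proof.
move=> sepAB.
pose C v := exists l a b, [/\ 0 < l, conv_hull A a, conv_hull B b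
                            & v = l *: (b - a)].
have CD v w : C v -> C w -> C (v + w).
  move=> [l [a [b [l0 Aa Bb ->]]]] [l' [a' [b' [l'0 Aa' Bb' ->]]]].
  have ll0 : 0 < l + l' by rewrite addr_gt0.
  pose k := l' / (l + l').
  have k0 : 0 <= k by rewrite divr_ge0 ?ltW.
  have k1 : k <= 1 by rewrite ler_pdivrMr// mul1r lerDr ltW.
  have e2 : (l + l') * k = l' by rewrite mulrC divfK ?gt_eqF.
  have e1 : (l + l') * (1 - k) = l by rewrite mulrBr mulr1 e2 addrK.
  exists (l + l'), ((1 - k) *: a + k *: a'), ((1 - k) *: b + k *: b').
  split=> //; try exact: conv_hull_conv.
  have comb (x y x' y' : R) :
      (l + l') * ((1 - k) * x + k * x' - ((1 - k) * y + k * y')) =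
      l * (x - y) + l' * (x' - y').
    by rewrite -[in RHS]e2 -[X in X * (x - y)]e1; lra.
  by apply: plane_eq; rewrite !mxE comb.
have CZ (l : R) v : 0 < l -> C v -> C (l *: v).
  move=> l0 [l' [a [b [l'0 Aa Bb ->]]]]; exists (l * l'), a, b.
  by rewrite scalerA mulr_gt0.
have C0 : ~ C 0.
  move=> [l [a [b [l0 Aa Bb /esym/eqP]]]].
  rewrite scaler_eq0 gt_eqF//= subr_eq0 => /eqP eba.
  have : (conv_hull A `&` conv_hull B)%classic a by split; rewrite // -eba.
  by rewrite sepAB.
have [v|u uP] := @open_half_plane C
    [seq b - a | a <- enum_fset A, b <- enum_fset B] CD CZ C0.
  move=> /allpairsP[[a b] /= [aA bB ->]].
  exists 1, a, b; split; rewrite ?scale1r ?ltr01//; exact: sub_conv_hull.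
exists u => a b aA bB; rewrite -subr_gt0.
have -> : dot u b - dot u a = dot u (b - a) by rewrite /dot !mxE; lra.
by apply: uP; apply: allpairs_f.
Qed.

End Separation.

(** * From dual lines back to the plane *)

Section Coordinates.
Variables (R : realType).
Local Notation plane := 'rV[R]_2.
Variables (X Y : plane -> R).
Implicit Types (p q r a b c : plane) (x l : R) (A B S : {fset plane}).

Hypothesis X_conv : forall l p q,
  X ((1 - l) *: p + l *: q) = (1 - l) * X p + l * X q.
Hypothesis Y_conv : forall l p q,
  Y ((1 - l) *: p + l *: q) = (1 - l) * Y p + l * Y q.
Hypothesis XY_inj : forall p q, X p = X q -> Y p = Y q -> p = q.

Let h := dual X Y.

Lemma dual_conv l p q x :
  h ((1 - l) *: p + l *: q) x = (1 - l) * h p x + l * h q x.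
Proof. by rewrite /h /dual X_conv Y_conv; lra. Qed.

Lemma dual_inj p q x x' : x != x' -> h p x = h q x -> h p x' = h q x' -> p = q.
Proof.
rewrite /h /dual => nx e1 e2.
have eX : X p = X q.
  have : (X p - X q) * (x - x') == 0 by apply/eqP; lra.
  by rewrite mulf_eq0 !subr_eq0 (negPf nx) orbF => /eqP.
by apply: XY_inj => //; move: e1; rewrite eX => /addrI/oppr_inj.
Qed.

(** Points with concurrent dual lines are collinear. *)
Lemma line_of_dual p q r x :
  p != q -> h p x = h q x -> h p x = h r x -> line p q r.
Proof.
rewrite /h /dual => npq e1 e2.
have nX : X q - X p != 0.
  rewrite subr_eq0; apply: contraNneq npq => eX; apply/eqP/XY_inj => //.
  by move: e1; rewrite eX => /addrI/oppr_inj.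
pose l := (X r - X p) / (X q - X p).
have lE : l * (X q - X p) = X r - X p by rewrite divfK.
exists l; apply: XY_inj; rewrite ?X_conv ?Y_conv; first by lra.
have -> : Y p = X p * x - (X r * x - Y r) by lra.
have -> : Y q = X q * x - (X r * x - Y r) by lra.
have : l * (X q - X p) * x = (X r - X p) * x by rewrite lE.
by lra.
Qed.

(** The weighted mean of [p] and [q] whose dual line passes at height [y]. *)
Lemma conv_dual_height p q x (y : R) : h p x < y -> y < h q x ->
  exists l, 0 < l < 1 /\ h ((1 - l) *: p + l *: q) x = y.
Proof.
move=> lt1 lt2; have d0 : 0 < h q x - h p x by lra.
exists ((y - h p x) / (h q x - h p x)); split.
  by rewrite divr_gt0 ?ltr_pdivrMr//=; lra.
have : (y - h p x) / (h q x - h p x) * (h q x - h p x) = y - h p x.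
  by rewrite divfK ?gt_eqF.
by rewrite dual_conv; lra.
Qed.

Lemma line_meets_hull B p c b b' x : p != c -> h p x = h c x ->
    b \in B -> b' \in B -> h p x < h b x -> h b' x < h p x ->
  exists2 z, line p c z & conv_hull B z.
Proof.
move=> npc epc bB b'B lt1 lt2.
have [l [/andP[l0 l1] e]] := conv_dual_height lt2 lt1.
exists ((1 - l) *: b' + l *: b); first exact: (line_of_dual npc epc).
by apply: conv_hull_conv; rewrite ?ltW//; apply: sub_conv_hull.
Qed.

Lemma segments_meet a b a' b' x x' : x != x' ->
    h a x = h b x -> h a' x' = h b' x' ->
    h b' x < h a x -> h a x < h a' x -> h a x' < h a' x' -> h a' x' < h b x' ->
  exists2 z, open_segment a b z & open_segment a' b' z.
Proof.
move=> nx e e' lt1 lt2 lt3 lt4.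
have [l [l01 le]] := conv_dual_height lt3 lt4.
have [k [k01 ke]] := conv_dual_height lt1 lt2.
exists ((1 - l) *: a + l *: b); first by exists l.
exists (1 - k); split; first by lra.
rewrite subKr [RHS]addrC; apply: (dual_inj nx).
  by rewrite -/h dual_conv -e ke; lra.
by rewrite -/h le dual_conv -e'; lra.
Qed.

Lemma no_concurrent_general_position S (p q r : S) x : general_position S ->
  p != q -> p != r -> q != r ->
  dual (X \o val) (Y \o val) p x = dual (X \o val) (Y \o val) q x ->
  dual (X \o val) (Y \o val) p x <> dual (X \o val) (Y \o val) r x.
Proof.
move=> gpS npq npr nqr e1 e2.
have := line_of_dual (p := val p) (q := val q) (r := val r) npq e1 e2.
by apply: gpS; rewrite ?fsvalP.
Qed.

(** The pairs of points of [A] whose line meets the hull of [B]. *)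
Definition meeting_pairs A B :=
  [fset s in pairs A |
    `[< (pair_line s `&` conv_hull B !=set0)%classic >]]%fset.

Lemma pairs_fset2 S p q : p \in S -> q \in S -> p != q ->
  [fset p; q]%fset \in pairs S.
Proof.
move=> pS qS npq; rewrite !inE fpowersetE cardfs2 npq eqxx andbT.
by apply/fsubsetP => r /fset2P[] ->.
Qed.

Lemma card_defective S A B (SA : {set S}) :
    (forall t, (t \in SA) = (val t \in A)) ->
    (forall t : S, val t \notin A -> val t \in B) ->
  (#|[set w | defective (X \o val) (Y \o val) SA w]| <=
     #|` meeting_pairs A B|)%N.
Proof.
move=> SAE SAB; set D := [set w | _].
pose seg (w : S * S) := [fset val w.1; val w.2]%fset.
have seg_inj : {in enum D &, injective seg}.
  move=> [a c] [a' c']; rewrite !mem_enum !inE /defective /=.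
  move=> /and5P[_ _ lt _ _] /and5P[_ _ lt' _ _] e.
  have /fset2P[ea|ea] : val a \in seg (a', c') by rewrite -e /seg !inE eqxx.
    have /fset2P[ec|ec] : val c \in seg (a', c').
      by rewrite -e /seg !inE eqxx orbT.
      by move: lt; rewrite ea ec /= ltxx.
    by congr (_, _); apply: val_inj.
  have /fset2P[ec|ec] : val c \in seg (a', c').
  - by rewrite -e /seg !inE eqxx orbT.
  - by move: lt lt'; rewrite ea ec /= => /lt_trans/[apply]; rewrite ltxx.
  - by move: lt; rewrite ea ec /= ltxx.
rewrite cardE -(size_map seg); apply: uniq_leq_size.
  by rewrite map_inj_in_uniq ?enum_uniq.
move=> _ /mapP[[a c] + ->]; rewrite mem_enum inE => /and5P[/=].
rewrite !SAE => aA cA lt /existsP[b /andP[]].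
rewrite SAE => /SAB bB hb /existsP[b' /andP[]].
rewrite SAE => /SAB b'B hb'.
have nac : val a != val c by apply: contraTneq lt => ->; rewrite ltxx.
rewrite inE /=; apply/andP; split; first exact: pairs_fset2.
apply/asboolP.
have [z zl zB] := line_meets_hull nac (dual_cross Y lt) bB b'B hb hb'.
by exists z; split => //; exists (val a), (val c).
Qed.

End Coordinates.

(** * The partition into crossing families *)

(** The deleted segments are those that are not good, and the families consist
    of the good segments of each level. The last inequality counts the segments
    that are left. *)
Lemma crossing_partition (R : realType) (m : nat) (A B : {fset 'rV[R]_2}) :
    (1 <= m)%N -> #|` A| = m -> #|` B| = m -> separated A B ->
    general_position (A `|` B)%fset ->
  exists (D : {fset {fset 'rV[R]_2}})
         (F : 'I_(2 * m - 1) -> {fset {fset 'rV[R]_2}}),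
    [/\ (D `<=` joining_segments A B)%fset,
        (#|` D| <= 2 * avoidance_defect A B)%N,
        partitioned_into F (joining_segments A B `\` D)%fset,
        (forall i, crossing_family (A `|` B)%fset (F i)) &
        (m ^ 2 <= \sum_i #|` F i| + 2 * avoidance_defect A B)%N].
Proof.
move=> m_gt0 cardA cardB sepAB genAB.
have [u uP] := separated_dot sepAB.
have [a0 a0A] : exists a0, a0 \in A.
  by apply/fset0Pn; rewrite -cardfs_gt0 cardA.
have [b0 b0B] : exists b0, b0 \in B.
  by apply/fset0Pn; rewrite -cardfs_gt0 cardB.
have u_neq0 : u != 0.
  by apply: contraTneq (uP _ _ a0A b0B) => ->; rewrite /dot !mxE; lra.
have disjAB p : p \in A -> p \in B -> False.
  by move=> pA pB; have := uP _ _ pA pB; rewrite ltxx.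
pose X := dot u; pose Y := det2 u; pose NX p := - X p.
have X_conv l p q : X ((1 - l) *: p + l *: q) = (1 - l) * X p + l * X q.
  by rewrite /X dotDr !dotZr.
have Y_conv l p q : Y ((1 - l) *: p + l *: q) = (1 - l) * Y p + l * Y q.
  by rewrite /Y det2Dr !det2Zr.
have XY_inj p q : X p = X q -> Y p = Y q -> p = q by apply: dot_det2_inj.
have NX_conv l p q : NX ((1 - l) *: p + l *: q) = (1 - l) * NX p + l * NX q.
  by rewrite /NX X_conv; lra.
have NXY_inj p q : NX p = NX q -> Y p = Y q -> p = q.
  by move=> /oppr_inj; apply: XY_inj.
pose S := (A `|` B)%fset.
pose XS (t : S) := X (val t); pose YS (t : S) := Y (val t).
pose SA := [set t : S | val t \in A].
have SAN (t : S) : (t \notin SA) = (val t \in B).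
  rewrite inE; have := valP t; rewrite in_fsetU.
  by case: (boolP (val t \in A)) => [/disjAB tA _|_ //]; apply/esym/negP.
have no_conc p q r x : p != q -> p != r -> q != r ->
    dual XS YS p x = dual XS YS q x -> dual XS YS p x <> dual XS YS r x.
  exact: no_concurrent_general_position genAB.
have XS_lt a b : a \in SA -> b \notin SA -> XS a < XS b.
  by rewrite SAN inE; apply: uP.
pose K (v : S * S) := segment_level XS YS v.1 v.2.
pose seg (v : S * S) := [fset val v.1; val v.2]%fset.
pose G := [set v in bichromatic SA | good XS YS SA v].
pose N := [set v in bichromatic SA | ~~ good XS YS SA v].
have bichromaticP v : v \in bichromatic SA -> val v.1 \in A /\ val v.2 \in B.
  by rewrite inE SAN inE => /andP[].
have seg_inj : {in bichromatic SA &, injective seg}.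
  move=> [a b] [a' b'] /bichromaticP[/= aA bB] /bichromaticP[/= a'A b'B] e.
  congr (_, _); apply: val_inj => /=.
    have /fset2P[//|ea] : val a \in seg (a', b') by rewrite -e /seg !inE eqxx.
    by case: (disjAB (val a)); rewrite // ea.
  have /fset2P[eb|//] : val b \in seg (a', b').
    by rewrite -e /seg !inE eqxx orbT.
  by case: (disjAB (val b)); rewrite // eb.
have joiningE s :
    reflect (exists2 v, v \in bichromatic SA & s = seg v)
            (s \in joining_segments A B).
  apply: (iffP (imfset2P _ _ _ _ _)) => [[a aA [b bB ->]]|[v vS ->]].
    have aS : a \in S by rewrite in_fsetU; apply/orP; left.
    have bS : b \in S by rewrite in_fsetU; apply/orP; right.
    by exists ([` aS], [` bS])%fset; rewrite // inE SAN inE /=; apply/andP.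
  have [aA bB] := bichromaticP _ vS.
  by exists (val v.1) => //; exists (val v.2).
have cardSA : #|SA| = m.
  rewrite -cardA -[LHS](_ : #|` [fset val t | t in SA]%fset| = _).
    congr (#|` _|); apply/fsetP => p; apply/imfsetP/idP => [[t + ->]|pA].
      by rewrite inE.
    have pS : p \in S by rewrite in_fsetU pA.
    by exists [` pS]%fset; rewrite //= inE.
  by rewrite card_imfset ?cardE//; apply: val_inj.
have cardSAC : #|~: SA| = m.
  rewrite -cardB -[LHS](_ : #|` [fset val t | t in ~: SA]%fset| = _).
    congr (#|` _|); apply/fsetP => p; apply/imfsetP/idP => [[t + ->]|pB].
      by rewrite /= finset.in_setC SAN.
    have pS : p \in S by rewrite in_fsetU pB orbT.
    by exists [` pS]%fset; rewrite //= finset.in_setC SAN.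
  by rewrite card_imfset ?cardE//; apply: val_inj.
have K_lt v : v \in bichromatic SA -> (K v < 2 * m - 1)%N.
  move=> vS; have XS_v : XS v.1 < XS v.2.
    by have [? ?] := bichromaticP _ vS; apply: uP.
  have dual_v := dual_cross YS XS_v.
  have cardS : #|{: S}| = (2 * m)%N.
    by rewrite -(cardsC SA) cardSA cardSAC mul2n addnn.
  have := cardsC [set v.1; v.2]; rewrite cards2 cardS.
  have -> : v.1 != v.2 by apply: contraTneq XS_v => ->; rewrite ltxx.
  (* the lines of the two endpoints are not below their crossing *)
  have : (K v <= #|~: [set v.1; v.2]|)%N.
    apply/subset_leq_card/fintype.subsetP => q.
    rewrite !inE negb_or cross_atC => lt_q.
    by apply/andP; split; apply: contraTneq lt_q => ->; rewrite -?dual_v ltxx.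
  by move=> le e; rewrite -e addnC addn2 subn1.
pose G_ (i : 'I_(2 * m - 1)) := [set v in G | K v == i :> nat].
exists [fset seg v | v in N]%fset, (fun i => [fset seg v | v in G_ i]%fset).
have memG i v : v \in G_ i ->
    [/\ v \in bichromatic SA, good XS YS SA v & K v = i].
  by rewrite !inE => /andP[/andP[-> ->] /eqP].
have memN v : v \in N -> v \in bichromatic SA /\ ~~ good XS YS SA v.
  by rewrite !inE => /andP[].
have cardN : (#|N| <= 2 * avoidance_defect A B)%N.
  apply: leq_trans (card_not_good no_conc XS_lt) _; rewrite leq_mul2l /=.
  apply: leq_add.
    apply: (card_defective X_conv Y_conv XY_inj) => t; first by rewrite inE.
    by have := SAN t; rewrite inE => ->.
  apply: (card_defective NX_conv Y_conv NXY_inj) => t.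
    by rewrite finset.in_setC SAN.
  by rewrite -SAN negbK inE.
split.
- apply/fsubsetP => _ /imfsetP[v /memN[vS _] ->]; apply/joiningE.
  by exists v.
- by apply: leq_trans cardN; rewrite (leq_trans (leq_imfset_card _ _ _)) ?cardE.
- split; last first.
    move=> i j nij; apply/fdisjointP => _ /imfsetP[v /memG[vS _ Kv] ->].
    apply/negP => /imfsetP[w /memG[wS _ Kw] /seg_inj e].
    case/negP: nij; apply/eqP/val_inj; rewrite -[LHS]Kv -[RHS]Kw.
    by rewrite e.
  apply/fsetP => s; rewrite in_fsetD; apply/bigfcupP/andP => [|[sN]].
    move=> [i _ /imfsetP[v /memG[vS vG _] ->]]; split; last first.
      by apply/joiningE; exists v.
    apply/negP => /imfsetP[w /memN[wS wG] /seg_inj e].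
    by move: wG; rewrite -e ?vG.
  move=> /joiningE[v vS es]; exists (Ordinal (K_lt v vS)).
    by rewrite mem_enum.
  apply/imfsetP; exists v => //=; apply/setIdP; split=> //; apply/setIdP.
  split=> //; apply: contraNT sN => vN; rewrite es; apply/imfsetP.
  by exists v => //=; apply/setIdP.
- move=> i; split.
    apply/fsubsetP => _ /imfsetP[v /memG[vS _ _] ->].
    have [vA vB] := bichromaticP _ vS.
    apply: pairs_fset2; rewrite ?in_fsetU ?vA ?vB ?orbT//.
    by apply/eqP => e; apply: (disjAB (val v.1)); rewrite // e.
  suff cross v w : v \in G_ i -> w \in G_ i ->
      cross_at XS YS v.1 v.2 < cross_at XS YS w.1 w.2 ->
      [disjoint seg v & seg w]%fset /\
      (segment_relint (seg v) `&` segment_relint (seg w) !=set0)%classic.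
    move=> _ _ /imfsetP[v vG ->] /imfsetP[w wG ->] nvw.
    have [[vS _ Kv] [wS _ Kw]] := (memG _ _ vG, memG _ _ wG).
    have {}nvw : v != w by apply: contraNneq nvw => ->.
    have Kvw : K v = K w by rewrite Kv Kw.
    have := same_level_cross_neq no_conc XS_lt vS wS nvw Kvw.
    case: ltgtP => // [lt _|lt _]; first exact: cross.
    by rewrite fdisjoint_sym setIC; apply: cross.
  move=> /memG[vS vG Kv] /memG[wS wG Kw] lt.
  have [|lt1 lt2 lt3 lt4] := good_cross XS_lt vS wS vG wG _ lt.
    by rewrite -/(K v) -/(K w) Kv Kw.
  have [[vA vB] [wA wB]] := (bichromaticP _ vS, bichromaticP _ wS).
  have ev : dual X Y (val v.1) (cross_at XS YS v.1 v.2) =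
            dual X Y (val v.2) (cross_at XS YS v.1 v.2).
    by rewrite cross_atC; apply/esym/(dual_cross Y); apply: uP.
  have ew : dual X Y (val w.1) (cross_at XS YS w.1 w.2) =
            dual X Y (val w.2) (cross_at XS YS w.1 w.2).
    by rewrite cross_atC; apply/esym/(dual_cross Y); apply: uP.
  split.
    apply/fdisjointP => p /fset2P[] ->; apply/negP => /fset2P[] e.
    - by move: lt2; rewrite /dual /XS /YS /= e ltxx.
    - by apply: (disjAB (val v.1)); rewrite // e.
    - by apply: (disjAB (val v.2)); rewrite // e.
    - have : dual X Y (val w.1) (cross_at XS YS w.1 w.2) <
             dual X Y (val v.2) (cross_at XS YS w.1 w.2) := lt4.
      by rewrite ew e ltxx.
  have [z z1 z2] := segments_meet X_conv Y_conv XY_inj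
    (negbT (lt_eqF lt)) ev ew lt1 lt2 lt3 lt4.
  exists z; split.
    exists (val v.1), (val v.2); split=> //.
    by apply/eqP => e; apply: (disjAB (val v.1)); rewrite // e.
  exists (val w.1), (val w.2); split=> //.
  by apply/eqP => e; apply: (disjAB (val w.1)); rewrite // e.
- have cardF i : #|` [fset seg v | v in G_ i]%fset| = #|G_ i|.
    rewrite card_in_imfset ?cardE// => v w /memG[vS _ _] /memG[wS _ _].
    exact: seg_inj.
  rewrite (eq_bigr _ (fun i _ => cardF i)).
  apply: leq_trans (leq_add (leqnn _) cardN).
  have -> : (m ^ 2 = #|bichromatic SA|)%N.
    have -> : bichromatic SA = finset.setX SA (~: SA).
      by apply/finset.setP => v; rewrite !inE.
    by rewrite cardsX cardSA cardSAC.
  have -> : (\sum_i #|G_ i| = #|G|)%N.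
    transitivity (\sum_(i < 2 * m - 1) \sum_(v in G | K v == i :> nat) 1)%N.
      apply: eq_bigr => i _; rewrite sum1dep_card; apply: eq_card => v.
      by rewrite !inE.
    rewrite (exchange_big_dep (mem G)) /=; last by move=> i v _ /andP[].
    rewrite -sum1_card; apply: eq_bigr => v vG.
    have vS : v \in bichromatic SA by move: vG; rewrite inE => /andP[].
    rewrite (big_pred1 (Ordinal (K_lt v vS))) // => i.
    by rewrite vG /= eq_sym.
  apply: leq_trans (leq_card_setU _ _); apply/subset_leq_card.
  by apply/fintype.subsetP => v; rewrite !inE => ->; case: (good _ _ _ _).
Qed.

Theorem proposition1p3 (R : realType) (m : nat) (A B : {fset 'rV[R]_2})
    (m_ge1 : (1 <= m)%N)
    (cardA : #|` A| = m) (cardB : #|` B| = m)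
    (sepAB : separated A B)
    (genAB : general_position (A `|` B)%fset) :
  (exists (D : {fset {fset 'rV[R]_2}})
          (F : 'I_(2 * m - 1) -> {fset {fset 'rV[R]_2}}),
     [/\ (D `<=` joining_segments A B)%fset,
         (#|` D| <= 2 * avoidance_defect A B)%N,
         partitioned_into F (joining_segments A B `\` D)%fset,
         (forall i, crossing_family (A `|` B)%fset (F i)) &
         exists i, ((m ^ 2)%:R - (2 * avoidance_defect A B)%:R)
                     / (2 * m - 1)%:R <= #|` F i|%:R :> R]) /\
  ((avoidance_defect A B)%:R <= (m ^ 2)%:R / 4 :> R ->
     exists F : {fset {fset 'rV[R]_2}},
       crossing_family (A `|` B)%fset F /\ m%:R / 4 <= #|` F|%:R :> R).
Proof.
have [D [F [DJ cardD partF crossF sumF]]] :=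
  crossing_partition m_ge1 cardA cardB sepAB genAB.
set t := avoidance_defect A B in cardD sumF *.
have n_gt0 : (0 < 2 * m - 1)%N by lia.
have [i Fi] : exists i,
    ((m ^ 2)%:R - (2 * t)%:R) / (2 * m - 1)%:R <= #|` F i|%:R :> R.
  pose i := [arg max_(i > Ordinal n_gt0) #|` F i|]%N.
  have imax j : (#|` F j| <= #|` F i|)%N.
    by rewrite /i; case: arg_maxnP => // k _; apply.
  exists i; rewrite ler_pdivrMr ?ltr0n// lerBlDr -natrM -natrD ler_nat.
  apply: leq_trans sumF _; rewrite leq_add2r.
  have -> : (#|` F i| * (2 * m - 1) = \sum_(j < 2 * m - 1) #|` F i|)%N.
    by rewrite sum_nat_const card_ord mulnC.
  exact: leq_sum.
split; first by exists D, F; split => //; exists i.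
move=> le_t; exists (F i); split; first exact: crossF.
apply: le_trans Fi; rewrite ler_pdivlMr ?ltr0n// natrB; last by lia.
rewrite natrX in le_t; rewrite natrX !natrM.
have m_ge0 : 0 <= m%:R :> R by rewrite ler0n.
by nra.
Qed.
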